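(* Let $\mathbb{D}=\{z\in\mathbb{C}:|z|<1\}$. There exists a quasiconformal map $f:\mathbb{D}\to\mathbb{D}$ such that for every $R>0$ there exist distinct generalized derivatives $g_1,g_2\in T(0,f)$ which agree on $\{z\in\mathbb{C}:|z|<R\}$.
   Context: Identify $\mathbb{C}$ with $\mathbb{R}^2$. A map is quasiconformal if it is an injective quasiregular mapping, where a continuous map $f:U\to\mathbb{R}^2$ on a planar domain $U$ is quasiregular if $f\in W^{1}_{2,\mathrm{loc}}(U)$ (first-order weak derivatives locally in $L^2$) and there is $K\in[1,\infty)$ with $|f'(x)|^2\le K J_f(x)$ for almost every $x\in U$ ($|f'(x)|$ the operator norm, $J_f$ the Jacobian determinant). For a non-constant quasiregular $f$ on $\mathbb{D}$ and $0<t<1$, put (at the base point $0$) $$f_t(z)=\frac{f(tz)-f(0)}{\rho_f(t)}\quad (|z|<1/t),\qquad \rho_f(r)=\left(\frac{\lambda[f(B(0,r))]}{\lambda[B(0,1)]}\right)^{1/2},$$ where $\lambda$ is planar Lebesgue measure and $B(0,r)$ is the Euclidean disk. A generalized derivative of $f$ at $0$ is a mapping $\varphi:\mathbb{C}\to\mathbb{C}$ of the form $\varphi=\lim_{k\to\infty}f_{t_k}$, with convergence locally uniform on $\mathbb{C}$, for some decreasing sequence $t_k\to0$ of positive numbers. The infinitesimal space $T(0,f)$ is the set of all generalized derivatives of $f$ at $0$. *)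

(* Defs.v *)
From HB Require Import structures.
From mathcomp Require Import all_boot all_order all_algebra.
From mathcomp Require Import all_classical all_reals all_analysis.

Set Implicit Arguments.
Unset Strict Implicit.
Unset Printing Implicit Defensive.

Import Order.TTheory GRing.Theory Num.Theory.
Import numFieldNormedType.Exports.

Local Open Scope classical_set_scope.
Local Open Scope ring_scope.

(* C is identified with R * R.  The library's norm on a product is the sup
   norm: it gives the right topology, uniformity and derivatives, but the
   modulus and round disks have to be written with the Euclidean norm. *)
Definition plane (R : realType) := (R * R)%type.

(* [plane R] with its Borel sigma-algebra.  [measurableTypeR R] is R with the
   Borel sets; on R itself, inference may find another sigma-algebra, so
   everything measure-theoretic below is typed with this alias. *)
Definition mplane (R : realType) := (measurableTypeR R * measurableTypeR R)%type.

Section Quasiregular.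
Context {R : realType}.
Implicit Types (U : set (plane R)) (u g phi : plane R -> R)
  (f : plane R -> plane R).

Definition enorm (z : plane R) : R := Num.sqrt (z.1 ^+ 2 + z.2 ^+ 2).

Definition disk (r : R) : set (plane R) := [set z | enorm z < r].

Definition lambda2 : {measure set (mplane R) -> \bar R} :=
  (@lebesgue_measure R \x @lebesgue_measure R)%E.

Definition L2_loc U g :=
  @measurable_fun _ _ (mplane R) (measurableTypeR R) U g /\
  forall K : set (plane R), K `<=` U -> compact K ->
    (\int[lambda2]_(z in (K : set (mplane R))) ((g z) ^+ 2)%:E < +oo)%E.

(* C^oo: all iterated directional derivatives are differentiable. *)
Definition smooth phi :=
  forall (s : seq (plane R)) (z : plane R),
    differentiable (foldr (fun v h => 'D_v h) phi s) z.

Definition test_function U phi :=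
  let supp := closure [set z | phi z != 0] in
  [/\ smooth phi, compact supp & supp `<=` U].

Definition weak_derivative U (v : plane R) u g :=
  forall phi, test_function U phi ->
    \int[lambda2]_(z in (U : set (mplane R))) (u z * 'D_v phi z) =
    - \int[lambda2]_(z in (U : set (mplane R))) (g z * phi z).

(* u is in W^1_{2,loc}(U) with weak partial derivatives ux and uy. *)
Definition W12_loc U u ux uy :=
  [/\ L2_loc U u, L2_loc U ux, L2_loc U uy,
      weak_derivative U (1, 0) u ux & weak_derivative U (0, 1) u uy].

Definition mxapply (A : 'M[R]_2) (h : plane R) : plane R :=
  (A 0 0 * h.1 + A 0 1 * h.2, A 1 0 * h.1 + A 1 1 * h.2).

Definition opnorm (A : 'M[R]_2) : R :=
  sup [set enorm (mxapply A h) | h in [set h | enorm h <= 1]].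

(* f is in W^1_{2,loc}(U) with weak Jacobian matrix Df. *)
Definition weak_jacobian U f (Df : plane R -> 'M[R]_2) :=
  W12_loc U (fun z => (f z).1) (fun z => Df z 0 0) (fun z => Df z 0 1) /\
  W12_loc U (fun z => (f z).2) (fun z => Df z 1 0) (fun z => Df z 1 1).

(* U is meant to be a domain; only the values of f on U matter.  Df is unique
   up to null sets, hence the existential quantification. *)
Definition quasiregular U f :=
  {within U, continuous f} /\
  exists2 Df : plane R -> 'M[R]_2, weak_jacobian U f Df &
    exists2 K : R, 1 <= K &
      {ae lambda2, forall z : mplane R, U z ->
         opnorm (Df z) ^+ 2 <= K * \det (Df z)}.

Definition quasiconformal U f := quasiregular U f /\ set_inj U f.

Definition mean_radius f (r : R) : R :=
  Num.sqrt (fine (lambda2 (f @` disk r)) / fine (lambda2 (disk 1))).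

(* Meaningful for enorm z < 1 / t when f is defined on the unit disk. *)
Definition rescale f (t : R) (z : plane R) : plane R :=
  (mean_radius f t)^-1 *: (f (t *: z) - f 0).

Definition cvg_locally_uniformly (F : nat -> plane R -> plane R) f :=
  forall z : plane R, exists2 V : set (plane R), nbhs z V &
    {uniform V, F @ \oo --> f}.

Definition generalized_derivative f (phi : plane R -> plane R) :=
  exists t : nat -> R,
    [/\ forall k, 0 < t k < 1, decreasing_seq t, t @ \oo --> (0 : R) &
        cvg_locally_uniformly (fun k => rescale f (t k)) phi].

Definition infinitesimal_space f : set (plane R -> plane R) :=
  [set phi | generalized_derivative f phi].

End Quasiregular.

(* Main.v *)
(* The map is f (x, y) = (x - e x, y), where e vanishes for x <= 0 and, on the
   positive axis, is made of tents of slope 1/2 and -1/2 and height c_k / 2 over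
   the non-overlapping intervals [c_k, 3 c_k], with c_k = 1 / (k + 2)!.  It is
   bi-Lipschitz with a diagonal derivative, hence quasiconformal.  Since
   c_(k+1) / c_k tends to 0, at the scale t_k = c_k / rho (rho >= 1) only the
   tent over [c_k, 3 c_k] remains visible: it is too far from 0 to influence the
   area of f (B (0, t_k)), which is asymptotic to that of B (0, t_k), and the
   smaller tents are negligible.  So f_(t_k) converges to the map g_rho that
   subtracts from x a single tent over [rho, 3 rho].  All these limits are the
   identity on |z| < rho, and they are pairwise distinct. *)

Require Import Defs.
From mathcomp Require Import all_boot all_order all_algebra.
From mathcomp Require Import all_classical all_reals all_analysis.
From mathcomp Require Import measurable_realfun ring lra.

Set Implicit Arguments.
Unset Strict Implicit.
Unset Printing Implicit Defensive.

Import Order.TTheory GRing.Theory Num.Theory.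
Import numFieldNormedType.Exports.

Local Open Scope classical_set_scope.
Local Open Scope ring_scope.

(** * Planar Lebesgue measure *)

Section PlaneMeasure.
Context {R : realType}.
Implicit Types (A : set (plane R)) (h : plane R -> R).

(** The product sigma-algebra is generated by rectangles, not by open sets, so [A] is written as a
    countable union of the rational rectangles that it contains. *)
Lemma open_mplane_measurable A : open A -> measurable (A : set (mplane R)).
Proof.
move=> oA.
pose B (q : (rat * rat) * (rat * rat)) : set (plane R) :=
  ball (ratr q.1.1 : R) (ratr q.1.2) `*` ball (ratr q.2.1 : R) (ratr q.2.2).
pose F q : set (mplane R) := if `[< B q `<=` A >] then B q else set0.
have -> : (A : set (mplane R)) = \bigcup_q F q.
  apply/seteqP; split=> [z Az|z [q _]]; last first.
    by rewrite /F; case: asboolP => [BA|_]; [exact: BA|].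
  have [[P Q] [/= Pz Qz] PQA] := open_nbhs_nbhs (conj oA Az).
  have zP : z.1 \in (interior P : set R) by rewrite inE.
  have zQ : z.2 \in (interior Q : set R) by rewrite inE.
  have [c [r [/set_mem cz cP]]] := open_subball_rat (open_interior P) zP.
  have [d [s [/set_mem dz dQ]]] := open_subball_rat (open_interior Q) zQ.
  exists ((c, r), (d, s)) => //; rewrite /F; case: asboolP => [_|[]].
    by split.
  move=> w [/= w1 w2]; apply: PQA; split.
    by apply: (@interior_subset _ P); exact: cP.
  by apply: (@interior_subset _ Q); exact: dQ.
apply: countable_bigcupT_measurable => // q; rewrite /F; case: asboolP => // _.
by apply: measurableX; apply: open_measurable; exact: ball_open.
Qed.

Lemma continuous_mplane_measurable h :
  continuous h -> @measurable_fun _ _ (mplane R) (measurableTypeR R) setT h.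
Proof.
move=> /continuousP ch; apply: (measurability _ (RGenOpens.measurableE R)).
move=> _ [_ [a [b ->] <-]]; rewrite setTI.
by apply: open_mplane_measurable; apply: ch; exact: interval_open.
Qed.

(** Uniqueness of Lebesgue measure: as a function of [X] the right-hand side is a measure with the
    correct values on half-open intervals. *)
Lemma lebesgue_measure_affine (a t : R) (X : set (measurableTypeR R)) :
  0 < t -> measurable X ->
  lebesgue_measure X =
  (t%:E * lebesgue_measure ((fun x : R => a + t * x)%R @^-1` X))%E.
Proof.
move=> t0 mX.
pose g : measurableTypeR R -> measurableTypeR R := fun x => a + t * x.
have mg : measurable_fun setT g.
  by apply: measurable_funD => //; apply: measurable_funM.
apply: (@lebesgue_measure_unique R
  (mscale (NngNum (ltW t0)) (pushforward lebesgue_measure g))) => //.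
move=> _ [[x y] _ <-].
change (lebesgue_measure (`]x, y]%classic : set R) =
  (t%:E * lebesgue_measure (g @^-1` `]x, y]%classic))%E).
have -> : g @^-1` `]x, y] = `](x - a) / t, (y - a) / t]%classic.
  apply/seteqP; split=> z /=; rewrite !in_itv/= /g ltr_pdivrMr// ler_pdivlMr//;
    rewrite mulrC => /andP[? ?]; apply/andP; split; lra.
rewrite !lebesgue_measure_itv/= !lte_fin ltr_pM2r ?invr_gt0// ltrD2r.
case: ifP => _; last by rewrite mule0.
rewrite -!EFinB -EFinM -mulrBl mulrC divfK ?gt_eqF//; congr EFin; lra.
Qed.

Lemma measurable_affine (a : plane R) (t : R) :
  @measurable_fun _ _ (mplane R) (mplane R) setT (fun z => a + t *: z).
Proof.
apply/measurable_fun_pairP; split.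
- apply: (@continuous_mplane_measurable (fun z => a.1 + t * z.1)) => z.
  apply: cvgD; first exact: cvg_cst.
  by apply: cvgM; [exact: cvg_cst|exact: cvg_fst].
- apply: (@continuous_mplane_measurable (fun z => a.2 + t * z.2)) => z.
  apply: cvgD; first exact: cvg_cst.
  by apply: cvgM; [exact: cvg_cst|exact: cvg_snd].
Qed.

(** Uniqueness of the product measure, checked on rectangles, where each coordinate contributes a
    factor [t]. It serves both translations ([t = 1]) and dilations of disks. *)
Lemma lambda2_affine (a : plane R) (t : R) (X : set (mplane R)) :
  0 < t -> measurable X ->
  lambda2 X = ((t ^+ 2)%:E * lambda2 ((fun z : plane R => a + t *: z)%R @^-1` X))%E.
Proof.
move=> t0 mX; have mg := measurable_affine a t.
have t20 : 0 <= t ^+ 2 by rewrite exprn_ge0// ltW.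
rewrite /lambda2.
apply: (@product_measure_unique _ _ (measurableTypeR R) (measurableTypeR R) R
  (@lebesgue_measure R) (@lebesgue_measure R)
  (mscale (NngNum t20) (pushforward lambda2
     (fun z : mplane R => (a + t *: (z : plane R)) : mplane R)))) => //.
move=> A B mA mB.
pose F (u : R) := (fun x : R => u + t * x).
change (((t ^+ 2)%:E * lambda2 ((F a.1 @^-1` A) `*` (F a.2 @^-1` B)))%E =
  (lebesgue_measure A * lebesgue_measure B)%E).
have mF u C : measurable (C : set (measurableTypeR R)) ->
    measurable (F u @^-1` C : set (measurableTypeR R)).
  move=> mC; rewrite -[X in measurable X]setTI.
  by apply: (_ : measurable_fun setT (F u)) => //;
     apply: measurable_funD => //; exact: measurable_funM.
have -> : lambda2 (F a.1 @^-1` A `*` F a.2 @^-1` B) =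
    (lebesgue_measure (F a.1 @^-1` A) * lebesgue_measure (F a.2 @^-1` B))%E.
  by apply: product_measure1E; exact: mF.
rewrite (lebesgue_measure_affine a.1 t0 mA) (lebesgue_measure_affine a.2 t0 mB).
by rewrite expr2 EFinM muleACA.
Qed.

End PlaneMeasure.

(** * Integration over the plane *)

Section PlaneIntegral.
Context {R : realType}.
Implicit Types (h u phi : plane R -> R) (v z a : plane R) (M C : R).

(** The sup norm makes this a square, so its compactness and its measure come from those of a
    segment. *)
Definition box M : set (plane R) := [set z | `|z| <= M].

Lemma box_setX M : box M = `[- M, M] `*` `[- M, M].
Proof.
apply/seteqP; split => z; rewrite /box/= prod_normE ge_max !in_itv/= !ler_norml.
  by move=> /andP.
by move=> [-> ->].
Qed.

Lemma measurable_box M : measurable (box M : set (mplane R)).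
Proof. by rewrite box_setX; apply: measurableX; exact: measurable_itv. Qed.

Lemma lambda2_box_lty M : (lambda2 (box M) < +oo)%E.
Proof.
rewrite box_setX.
have -> : lambda2 (`[- M, M] `*` `[- M, M]) =
    (lebesgue_measure (`[(- M)%R, M]%classic : set R) *
     lebesgue_measure (`[(- M)%R, M]%classic : set R))%E.
  by apply: product_measure1E; exact: measurable_itv.
rewrite !lebesgue_measure_itv/=; case: ifP => _; last by rewrite mule0.
by rewrite -EFinB -EFinM ltry.
Qed.

Lemma continuous_bounded_on_box h M :
  continuous h -> exists2 C : R, 0 <= C & forall z, `|z| <= M -> `|h z| <= C.
Proof.
move=> ch.
have cbox : compact (box M).
  by rewrite box_setX; apply: compact_setX; exact: segment_compact.
have /compact_bounded [C [_ hC]] : compact (h @` (box M)).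
  by apply: continuous_compact => //; exact: continuous_subspaceT.
exists (`|C| + 1) => [|z zM]; first by rewrite addr_ge0.
apply: (hC (`|C| + 1)); last by exists z.
by rewrite (le_lt_trans (ler_norm C))// ltrDl.
Qed.

Lemma bounded_support_integrable h M C :
  @measurable_fun _ _ (mplane R) (measurableTypeR R) setT h ->
  (forall z, M < `|z| -> h z = 0) -> (forall z, `|h z| <= C) ->
  (@lambda2 R).-integrable setT (EFin \o h).
Proof.
move=> mh hM hC; have mB := measurable_box M.
have hE : EFin \o h = (EFin \o h) \_ (box M).
  apply/funext => z; rewrite patchE; case: ifPn => //.
  by rewrite notin_setE /box/= => /negP; rewrite -ltNge => /hM /= ->.
rewrite hE -integrable_mkcond//; apply: measurable_bounded_integrable => //.
- exact: lambda2_box_lty.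
- exact: measurable_funTS.
- exists C; split; first exact: num_real.
  by move=> x Cx z _; exact: le_trans (hC z) (ltW Cx).
Qed.

Lemma lambda2_translation a (X : set (mplane R)) : measurable X ->
  lambda2 X = lambda2 ((fun z : plane R => (a + z)%R) @^-1` X).
Proof.
move=> mX; rewrite (lambda2_affine a ltr01 mX) expr1n mul1e.
by congr (lambda2 _); apply/funext => z; rewrite /preimage/= scale1r.
Qed.

Lemma Rintegral_translation a h :
  @measurable_fun _ _ (mplane R) (measurableTypeR R) setT h ->
  (@lambda2 R).-integrable setT (EFin \o (fun z => h (a + z))) ->
  \int[lambda2]_z h (a + z) = \int[lambda2]_z h z.
Proof.
move=> mh ih; rewrite /Rintegral; congr fine.
have ma : @measurable_fun _ _ (mplane R) (mplane R) setT (fun z => a + z).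
  have := measurable_affine a 1; congr (measurable_fun _ _).
  by apply/funext => z; rewrite scale1r.
transitivity (\int[pushforward lambda2
    (fun z : mplane R => (a + (z : plane R))%R : mplane R)]_z (h z)%:E)%E.
  rewrite integral_pushforward//.
  exact/measurable_EFinP.
by apply: eq_measure_integral => A mA _; rewrite [RHS](lambda2_translation a).
Qed.

End PlaneIntegral.

(** * Weak derivatives of Lipschitz functions *)

Section WeakDerivative.
Context {R : realType}.
Implicit Types (U : set (plane R)) (g h u phi : plane R -> R) (v z a : plane R)
  (M C : R).

(** The complement of the support is open, so [phi] vanishes on a whole neighbourhood of [z] and its
    derivatives at [z] vanish too. *)
Lemma test_function_off_support phi v z : ~ closure [set z | phi z != 0] z ->
  phi z = 0 /\ 'D_v phi z = 0.
Proof.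
move=> nz.
have near0 : \forall w \near z, phi w = 0.
  have /open_nbhs_nbhs : open_nbhs z (~` closure [set z | phi z != 0]).
    by split => //; rewrite openC; exact: closed_closure.
  apply: filterS => w /= nw; apply/eqP/negPn/negP => pw.
  by apply: nw; exact: subset_closure.
split; first exact: nbhs_singleton near0.
by rewrite (@near_eq_derive _ _ _ _ (cst 0) _ _ near0) derive_cst.
Qed.

Lemma test_function_box U phi : test_function U phi ->
  exists M : R, forall v z, M < `|z| -> phi z = 0 /\ 'D_v phi z = 0.
Proof.
case=> _ /compact_bounded [M [_ hM]] _.
exists (`|M| + 1) => v z zM.
apply: test_function_off_support => /(hM (`|M| + 1)).
rewrite (le_lt_trans (ler_norm M)) ?ltrDl//.
by move=> /(_ erefl)/=; rewrite leNgt zM.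
Qed.

Lemma smooth_continuous phi : smooth phi -> continuous phi.
Proof. by move=> sp z; exact/differentiable_continuous/(sp [::]). Qed.

Lemma smooth_derive_continuous phi v : smooth phi -> continuous ('D_v phi).
Proof. by move=> sp z; exact/differentiable_continuous/(sp [:: v]). Qed.

Lemma smooth_derivable phi v z : smooth phi -> derivable phi z v.
Proof. by move=> sp; exact/diff_derivable/(sp [::]). Qed.

(** Restriction to a line makes the one-variable mean value theorem available. *)
Lemma is_derive_line phi v z (s : R) : derivable phi (z + s *: v) v ->
  is_derive s 1 (fun t : R => phi (z + t *: v)) ('D_v phi (z + s *: v)).
Proof.
move=> dp.
have E : (fun h : R => h^-1 *: (((fun t : R => phi (z + t *: v)) \o shift s) (h *: 1)
      - phi (z + s *: v))) =
   (fun h : R => h^-1 *: ((phi \o shift (z + s *: v)) (h *: v)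
      - phi (z + s *: v))).
  apply/funext => h /=; congr (_ *: (phi _ - _)).
  by rewrite [h%:A]mulr1 scalerDl addrCA.
by split; rewrite /derivable /derive E.
Qed.

Lemma smooth_mean_value phi v z (s : R) : smooth phi -> 0 < s ->
  exists2 c, 0 < c < s & phi (z + s *: v) - phi z = s * 'D_v phi (z + c *: v).
Proof.
move=> sp s0.
have dl (t : R) : is_derive t 1 (fun t : R => phi (z + t *: v)) ('D_v phi (z + t *: v)).
  by apply: is_derive_line; exact: smooth_derivable.
have [|c cs E] := MVT s0 (fun t _ => dl t).
  apply: derivable_within_continuous => t _; exact: ex_derive.
exists c; first by move: cs; rewrite in_itv.
by move: E; rewrite scale0r addr0 subr0 mulrC.
Qed.

Lemma Dquotient_cvg phi v z : derivable phi z v ->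
  (fun n : nat => n.+1%:R * (phi (z + n.+1%:R^-1 *: v) - phi z)) @ \oo -->
  'D_v phi z.
Proof.
move=> dp.
have /cvgr_dnbhsP := dp.
move=> /(_ (fun n => n.+1%:R^-1)) H.
have /H : (forall n : nat, n.+1%:R^-1 != 0 :> R) /\
    n.+1%:R^-1 @[n --> \oo] --> (0 : R).
  by split; [move=> n; rewrite invr_eq0 pnatr_eq0|exact: cvg_harmonic].
move=> K; rewrite [X in X @ \oo --> _](_ : _ = fun n : nat => (n.+1%:R^-1 : R)^-1 *:
  ((phi \o shift z) (n.+1%:R^-1 *: v) - phi z)) //.
by apply/funext => n; rewrite invrK /= [_ *: v + z]addrC.
Qed.

(** Dominated convergence with majorant [C] times the indicator of the box; measurability, support
    and bound pass from the [F n] to [h]. *)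
Lemma box_dominated_cvg (F : nat -> plane R -> R) h M C :
  (forall n, @measurable_fun _ _ (mplane R) (measurableTypeR R) setT (F n)) ->
  (forall n z, M < `|z| -> F n z = 0) -> (forall n z, `|F n z| <= C) ->
  (forall z, F n z @[n --> \oo] --> h z) ->
  \int[lambda2]_z F n z @[n --> \oo] --> \int[lambda2]_z h z.
Proof.
move=> mF F0 FC Fh.
have mh : @measurable_fun _ _ (mplane R) (measurableTypeR R) setT h.
  by apply: (measurable_fun_cvg mF) => z _; exact: Fh.
have h0 z : M < `|z| -> h z = 0.
  move=> zM; apply: (cvg_unique _ (Fh z)) => //=.
  have -> : F ^~ z = cst 0 by apply/funext => n; exact: F0.
  exact: cvg_cst.
have hC z : `|h z| <= C.
  have cv : `|F n z| @[n --> \oo] --> `|h z| by exact: cvg_norm.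
  rewrite -(cvg_lim _ cv)//; apply: limr_le; first by apply/cvg_ex; exists `|h z|.
  by apply: nearW => n; exact: FC.
have C0 : 0 <= C by rewrite (le_trans _ (hC 0)).
pose G z := C * \1_(box M) z.
have iG : (@lambda2 R).-integrable setT (EFin \o G).
  apply: (bounded_support_integrable (M := M) (C := C)).
  - by apply: measurable_funM => //; apply: measurable_indic; exact: measurable_box.
  - move=> z zM; rewrite /G indicE memNset ?mulr0// /box/=.
    by rewrite leNgt zM.
  - move=> z; rewrite /G indicE normrM (ger0_norm C0) ler_piMr//.
    by case: (_ \in _); rewrite ?normr1 ?normr0.
have [] := @dominated_convergence _ (mplane R) R lambda2 setT measurableT
  (fun n => EFin \o F n) (EFin \o h) (EFin \o G).
- by move=> n; apply/measurable_EFinP; exact: mF.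
- exact/measurable_EFinP.
- by apply: aeW => z _; apply: cvg_EFin; [exact: nearW|exact: Fh].
- exact: iG.
- apply: aeW => z n _ /=; rewrite lee_fin /G indicE.
  have [zM|zM] := lerP `|z| M; first by rewrite mem_set ?mulr1.
  by rewrite F0// normr0 mulr_ge0.
move=> ih _ cF; apply: fine_cvg; rewrite fineK; first exact: cF.
exact: integrable_fin_num ih.
Qed.

Lemma continuous_box_integrable h M : continuous h ->
  (forall z, M < `|z| -> h z = 0) ->
  (@lambda2 R).-integrable setT (EFin \o h).
Proof.
move=> ch h0; have [C C0 hC] := continuous_bounded_on_box M ch.
apply: (bounded_support_integrable (M := M) (C := C)) => //.
  exact: continuous_mplane_measurable.
by move=> z; have [/hC//|/h0->] := lerP `|z| M; rewrite normr0.
Qed.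

Lemma Rintegral_extend U h : (forall z, ~ U z -> h z = 0) ->
  \int[lambda2]_(z in (U : set (mplane R))) h z = \int[lambda2]_z h z.
Proof.
move=> h0; rewrite Rintegral_mkcond; congr Rintegral; apply/funext => z.
by rewrite patchE; case: ifPn => //; rewrite notin_setE => /h0.
Qed.

Lemma continuous_translation a : continuous (fun z : plane R => a + z).
Proof. by move=> z; apply: cvgD; [exact: cvg_cst|exact: cvg_id]. Qed.

(** Discrete integration by parts: [u z * phi (z + s *: v)] is a translate of [P], hence has the
    same integral, and both sides equal [k] times the integral of [P] minus that of [Q]. *)
Lemma shift_quotient_by_parts u phi v M (k s : R) :
  continuous u -> continuous phi -> 0 < s <= 1 ->
  (forall z, M < `|z| -> phi z = 0) ->
  \int[lambda2]_z (u z * (k * (phi (z + s *: v) - phi z))) =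
  - \int[lambda2]_z (k * (u z - u (z - s *: v)) * phi z).
Proof.
move=> cu cp /andP[s0 s1] p0.
pose P z := u (z - s *: v) * phi z.
have cP : continuous P.
  move=> z; apply: cvgM; last exact: cp.
  apply: (continuous_comp (f := fun z => z - s *: v)); last exact: cu.
  by apply: cvgB; [exact: cvg_id|exact: cvg_cst].
have iP : (@lambda2 R).-integrable setT (EFin \o P).
  apply: (continuous_box_integrable cP (M := M)) => z /p0.
  by rewrite /P => ->; rewrite mulr0.
pose Q z := u z * phi z.
have cQ : continuous Q by move=> z; apply: cvgM; [exact: cu|exact: cp].
have iQ : (@lambda2 R).-integrable setT (EFin \o Q).
  apply: (continuous_box_integrable cQ (M := M)) => z /p0.
  by rewrite /Q => ->; rewrite mulr0.
have cPt : continuous (fun z => P (s *: v + z)).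
  by move=> z; apply: continuous_comp; [exact: continuous_translation|exact: cP].
(* Since [s <= 1], the translation moves the support by at most the norm of [v]. *)
have iPt : (@lambda2 R).-integrable setT (EFin \o (fun z => P (s *: v + z))).
  apply: (continuous_box_integrable cPt (M := M + `|v|)) => z zM.
  rewrite /P p0 ?mulr0//.
  have : `|z| <= `|s *: v + z| + `|s *: v|.
    have := ler_normB (s *: v + z) (s *: v).
    by rewrite (_ : _ - _ = z)// addrAC subrr add0r.
  have : `|s *: v| <= `|v| by rewrite normrZ gtr0_norm// ler_piMl.
  lra.
have -> : \int[lambda2]_z (u z * (k * (phi (z + s *: v) - phi z))) =
    \int[lambda2]_z (k * (P (s *: v + z) - Q z)).
  by apply: eq_Rintegral => z _; rewrite /P /Q [s *: v + z]addrC addrK; ring.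
have -> : \int[lambda2]_z (k * (u z - u (z - s *: v)) * phi z) =
    \int[lambda2]_z (k * (Q z - P z)).
  by apply: eq_Rintegral => z _; rewrite /P /Q; ring.
rewrite !RintegralZl//; first last.
- exact: (integrableB _ iPt iQ).
- exact: (integrableB _ iQ iP).
rewrite !RintegralB// Rintegral_translation//; first by ring.
exact: continuous_mplane_measurable.
Qed.

(* The left difference quotient of u is transferred to phi by a translation;
   then dominated convergence applies on both sides. *)
Lemma lipschitz_weak_derivative U v u g (L : R) : continuous u ->
  (forall z (s : R), 0 < s -> `|u z - u (z - s *: v)| <= L * s) ->
  (forall z, n.+1%:R * (u z - u (z - n.+1%:R^-1 *: v)) @[n --> \oo] --> g z) ->
  weak_derivative U v u g.
Proof.
move=> cu Lu ug phi tphi; have [sp _ suppU] := tphi.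
have [M phiM] := test_function_box tphi.
have [C C0 phiC] := continuous_bounded_on_box M (smooth_continuous sp).
have [D D0 DphiD] := continuous_bounded_on_box M (smooth_derive_continuous (v := v) sp).
have [B B0 uB] := continuous_bounded_on_box (M + `|v|) cu.
have {}phiC z : `|phi z| <= C.
  by have [/phiC//|/(phiM v)[-> _]] := lerP `|z| M; rewrite normr0.
have {}DphiD z : `|'D_v phi z| <= D.
  by have [/DphiD//|/(phiM v)[_ ->]] := lerP `|z| M; rewrite normr0.
have off z : ~ U z -> phi z = 0 /\ 'D_v phi z = 0.
  by move=> nU; apply: test_function_off_support => /suppU.
rewrite [LHS](Rintegral_extend (U := U)); last first.
  by move=> z /off[_ ->]; rewrite mulr0.
rewrite [in RHS](Rintegral_extend (U := U)); last first.
  by move=> z /off[-> _]; rewrite mulr0.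
have s01 (n : nat) : 0 < (n.+1%:R^-1 : R) <= 1.
  by rewrite invr_gt0 ltr0n/= invf_le1// ler1n.
have cphi := smooth_continuous sp.
(* The box is enlarged by the norm of [v] so that it contains the support of every translate of
   [phi] by a step at most 1. *)
have A0 (n : nat) z : M + `|v| < `|z| ->
    u z * (n.+1%:R * (phi (z + n.+1%:R^-1 *: v) - phi z)) = 0.
  move=> zM; have /andP[s0 s1] := s01 n; have v0 := normr_ge0 v.
  have [|-> _] := phiM v z; first by lra.
  have [|-> _] := phiM v (z + n.+1%:R^-1 *: v); last by rewrite subrr !mulr0.
  have : `|z| <= `|z + n.+1%:R^-1 *: v| + `|n.+1%:R^-1 *: v|.
    have := ler_normB (z + n.+1%:R^-1 *: v) (n.+1%:R^-1 *: v).
    by rewrite addrK.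
  have : `|n.+1%:R^-1 *: v| <= `|v| by rewrite normrZ gtr0_norm// ler_piMl.
  lra.
have cvA : \int[lambda2]_z (u z * (n.+1%:R * (phi (z + n.+1%:R^-1 *: v) - phi z)))
    @[n --> \oo] --> \int[lambda2]_z (u z * 'D_v phi z).
  apply: (box_dominated_cvg (M := M + `|v|) (C := B * D)).
  - move=> n; apply: continuous_mplane_measurable => z.
    apply: cvgM; first exact: cu.
    apply: cvgM; first exact: cvg_cst.
    apply: cvgB; last exact: cphi.
    apply: (continuous_comp (f := fun z => z + n.+1%:R^-1 *: v)); last exact: cphi.
    by apply: cvgD; [exact: cvg_id|exact: cvg_cst].
  - exact: A0.
  - move=> n z; have /andP[s0 s1] := s01 n.
    have [zM|zM] := lerP `|z| (M + `|v|); last first.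
      by rewrite (A0 n z zM) normr0 mulr_ge0.
    (* The increment of [phi] carries a factor [n.+1%:R^-1], which cancels [n.+1%:R] and leaves a
       bound uniform in [n]. *)
    have [c _ ->] := smooth_mean_value v z sp s0.
    by rewrite mulVKf ?pnatr_eq0// normrM ler_pM// uB.
  - move=> z; apply: cvgM; first exact: cvg_cst.
    exact/Dquotient_cvg/smooth_derivable.
have cvB : \int[lambda2]_z (n.+1%:R * (u z - u (z - n.+1%:R^-1 *: v)) * phi z)
    @[n --> \oo] --> \int[lambda2]_z (g z * phi z).
  apply: (box_dominated_cvg (M := M) (C := L * C)).
  - move=> n; apply: continuous_mplane_measurable => z.
    apply: cvgM; last exact: cphi.
    apply: cvgM; first exact: cvg_cst.
    apply: cvgB; first exact: cu.
    apply: (continuous_comp (f := fun z => z - n.+1%:R^-1 *: v)); last exact: cu.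
    by apply: cvgB; [exact: cvg_id|exact: cvg_cst].
  - by move=> n z /(phiM v)[-> _]; rewrite mulr0.
  - move=> n z; have /andP[s0 s1] := s01 n.
    rewrite normrM ler_pM// normrM gtr0_norm ?ltr0n// mulrC.
    by rewrite -ler_pdivlMr ?ltr0n// Lu.
  - by move=> z; apply: cvgM; [exact: ug|exact: cvg_cst].
(* By discrete integration by parts the two sequences of integrals are opposite, hence so are their
   limits. *)
apply: (cvg_unique _ cvA) => //=.
rewrite [X in X @ \oo --> _](_ : _ = fun n : nat =>
  - \int[lambda2]_z (n.+1%:R * (u z - u (z - n.+1%:R^-1 *: v)) * phi z)).
  exact: cvgN.
apply/funext => n; have p0 z : M < `|z| -> phi z = 0 by move=> /(phiM v)[].
exact: (shift_quotient_by_parts v n.+1%:R cu cphi (s01 n) p0).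
Qed.

End WeakDerivative.

(** * The sum of tents *)

Section Bumps.
Context {R : realType}.
Implicit Types (a r s t : R) (k : nat).

Definition tent a s : R := Num.max 0 ((a - `|s - 2 * a|) / 2).

Lemma tent_ge0 a s : 0 <= tent a s. Proof. by rewrite /tent le_max lexx. Qed.

Lemma tent_le a s : 0 <= a -> tent a s <= a / 2.
Proof.
move=> a0; rewrite /tent ge_max; have := normr_ge0 (s - 2 * a).
by move=> ?; apply/andP; split; lra.
Qed.

Lemma tent_left0 a s : s <= a -> tent a s = 0.
Proof.
move=> sa; apply/max_idPl; have := ler_norm (- (s - 2 * a)); rewrite normrN; lra.
Qed.

Lemma tent_right0 a s : 3 * a <= s -> tent a s = 0.
Proof. by move=> sa; apply/max_idPl; have := ler_norm (s - 2 * a); lra. Qed.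

Lemma tent_lipschitz a s t : tent a s <= tent a t + `|s - t| / 2.
Proof.
rewrite {1}/tent ge_max; have h := normr_ge0 (s - t).
have := tent_ge0 a t; have : (a - `|t - 2 * a|) / 2 <= tent a t.
  by rewrite /tent le_max lexx orbT.
have := ler_distD s t (2 * a); rewrite (distrC t s) => ? ? ?.
by apply/andP; split; lra.
Qed.

(** This homogeneity is why a rescaling by [scale k / rho] turns the tent of parameter [scale k]
    into the one of parameter [rho]. *)
Lemma tent_scale a s t : 0 <= t -> tent (t * a) (t * s) = t * tent a s.
Proof.
move=> t0; rewrite /tent maxr_pMr// mulr0; congr Num.max.
by rewrite mulrCA -mulrBr normrM (ger0_norm t0); ring.
Qed.

(** A break point is assigned to the affine piece on its left; [d] is the distance from [s] to the
    left end of the piece, or 1 when the piece is unbounded. *)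
Lemma tent_left_affine a s : exists w d : R,
  [/\ `|w| <= 1 / 2, 0 < d & forall h : R, 0 <= h < d ->
    tent a (s - h) = tent a s - w * h].
Proof.
have [sa|sa] := lerP s a.
  exists 0, 1; split => [||h /andP[h0 _]]; rewrite ?normr0 ?divr_ge0//.
  by rewrite !tent_left0//; lra.
have [sa3|sa3] := ltrP (3 * a) s.
  exists 0, (s - 3 * a); split => [||h /andP[h0 hd]];
    rewrite ?normr0 ?divr_ge0 ?subr_gt0//.
  by rewrite !tent_right0//; lra.
have [sa2|sa2] := ltrP (2 * a) s.
  exists (- (1 / 2)), (s - 2 * a); split => [||h /andP[h0 hd]]; first 2 last.
  - by rewrite /tent !ger0_norm; [|lra|lra]; rewrite !max_r; lra.
  - by rewrite normrN ger0_norm; lra.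
  - lra.
exists (1 / 2), (s - a); split => [||h /andP[h0 hd]]; first 2 last.
- by rewrite /tent !ler0_norm; [|lra|lra]; rewrite !max_r; lra.
- by rewrite ger0_norm; lra.
- lra.
Qed.

(** Consecutive ratios are [1 / (k + 3)]: they tend to 0, and are at most 1/3 from the start, so
    that the tents do not overlap. The shift by 2 also gives [scale 0 = 1 / 2], inside the unit
    disk. *)
Definition scale k : R := (k.+2`!)%:R^-1.

Lemma scale_gt0 k : 0 < scale k.
Proof. by rewrite invr_gt0 ltr0n fact_gt0. Qed.

Lemma scaleS k : scale k.+1 = scale k / k.+3%:R.
Proof. by rewrite /scale factS natrM invfM mulrC. Qed.

Lemma scaleS3 k : 3 * scale k.+1 <= scale k.
Proof.
rewrite scaleS mulrCA -[leRHS]mulr1 ler_pM2l ?scale_gt0//.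
by rewrite ler_pdivrMr ?ltr0n// mul1r ler_nat.
Qed.

Lemma scaleS_le k : scale k.+1 <= scale k.
Proof. by have := scaleS3 k; have := scale_gt0 k.+1; lra. Qed.

Lemma scale_le j k : (j <= k)%N -> scale k <= scale j.
Proof.
move=> /subnK <-; elim: (k - j)%N => // n IH; rewrite addSn.
exact: le_trans (scaleS_le _) IH.
Qed.

Lemma scale_lt1 k : scale k < 1.
Proof.
apply: (le_lt_trans (scale_le (leq0n k))).
by rewrite /scale invf_lt1 ?ltr1n ?ltr0n.
Qed.

Lemma scale_le_inv k : scale k <= k.+1%:R^-1.
Proof.
rewrite lef_pV2 ?posrE ?ltr0n ?fact_gt0// ler_nat factS.
by rewrite (leq_trans (leqnSn _))// leq_pmulr// fact_gt0.
Qed.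

Lemma scale_cvg0 : scale k @[k --> \oo] --> 0.
Proof.
apply: (@squeeze_cvgr _ _ _ _ (cst 0) (fun k => k.+1%:R^-1)).
- by apply: nearW => k; rewrite ltW ?scale_gt0//= scale_le_inv.
- exact: cvg_cst.
- exact: cvg_harmonic.
Qed.

(** At most one tent is positive at a given point, so the supremum is the sum of the series; bounds
    and the Lipschitz constant pass directly to a supremum. *)
Definition tents s : R := sup (range (fun k => tent (scale k) s)).

Let tents_has_sup s : has_sup (range (fun k => tent (scale k) s)).
Proof.
split; first by exists (tent (scale 0) s), 0%N.
exists 1 => _ [k _ <-]; have := tent_le s (ltW (scale_gt0 k)).
have := scale_lt1 k; lra.
Qed.

Lemma tent_le_tents k s : tent (scale k) s <= tents s.
Proof. by apply: ub_le_sup; [exact: (tents_has_sup s).2|exists k]. Qed.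

Lemma tents_le s r : (forall k, tent (scale k) s <= r) -> tents s <= r.
Proof.
move=> h; apply: ge_sup; first exact: (tents_has_sup s).1.
by move=> _ [k _ <-].
Qed.

Lemma tents_ge0 s : 0 <= tents s.
Proof. exact: le_trans (tent_ge0 _ _) (tent_le_tents 0 s). Qed.

Lemma tents_lipschitz s t : `|tents s - tents t| <= `|s - t| / 2.
Proof.
have H x y : tents x <= tents y + `|x - y| / 2.
  apply: tents_le => k; apply: le_trans (tent_lipschitz _ _ y) _.
  by rewrite lerD2r tent_le_tents.
rewrite ler_norml; have := H s t; have := H t s; rewrite (distrC t s) => ? ?.
by apply/andP; split; lra.
Qed.

Lemma tents_neg s : s <= 0 -> tents s = 0.
Proof.
move=> s0; apply/eqP; rewrite eq_le tents_ge0 andbT.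
by apply: tents_le => k; rewrite tent_left0// (le_trans s0)// ltW// scale_gt0.
Qed.

Lemma tents_le_half s : 0 <= s -> tents s <= s / 2.
Proof.
move=> s0; have := tents_lipschitz s 0.
by rewrite (tents_neg (lexx 0)) !subr0 (ger0_norm (tents_ge0 s)) ger0_norm.
Qed.

(** Larger tents start to the right of [s] and smaller ones end to its left. Quantifying over
    [j < k] makes the upper condition void for [k = 0], where no larger tent exists. *)
Lemma tents_local k s : 3 * scale k.+1 <= s -> (forall j, (j < k)%N -> s <= scale j) ->
  tents s = tent (scale k) s.
Proof.
move=> ks sk; apply/eqP; rewrite eq_le tent_le_tents andbT; apply: tents_le => j.
have [jk|kj|->//] := ltngtP j k.
  by rewrite tent_left0 ?tent_ge0// sk.
rewrite tent_right0 ?tent_ge0//; apply: le_trans ks.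
by rewrite ler_pM2l// scale_le.
Qed.

(** Near 0 smaller tents may also be positive, but their heights are at most [scale k.+1 / 2]. *)
Lemma tents_approx k s : (forall j, (j < k)%N -> s <= scale j) ->
  `|tents s - tent (scale k) s| <= scale k.+1.
Proof.
move=> sk; rewrite ger0_norm ?subr_ge0 ?tent_le_tents//.
rewrite lerBlDl; apply: tents_le => j.
have tk := tent_ge0 (scale k) s; have c0 := scale_gt0 k.+1.
have [jk|kj|->] := ltngtP j k; last by rewrite lerDl ltW.
  by rewrite tent_left0 ?sk// addr_ge0 // ltW.
have := tent_le s (ltW (scale_gt0 j)); have := scale_gt0 j.
have := scale_le kj; lra.
Qed.

Lemma tents_left_affine s : exists w d : R,
  [/\ `|w| <= 1 / 2, 0 < d & forall h : R, 0 <= h < d ->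
    tents (s - h) = tents s - w * h].
Proof.
have [s0|s0] := lerP s 0.
  exists 0, 1; split => [||h /andP[h0 _]]; rewrite ?normr0 ?divr_ge0//.
  by rewrite !tents_neg//; lra.
have [k ks] : exists k, 3 * scale k.+1 < s.
  have s30 : 0 < s / 3 by rewrite divr_gt0.
  have /cvgrPdist_lt /(_ _ s30) [N _ HN] := scale_cvg0.
  have := HN N.+1 (leqnSn N); rewrite /= sub0r normrN gtr0_norm ?scale_gt0// => ?.
  by exists N; lra.
(* Minimality of [k] gives [s <= 3 * scale k] when [k] is positive, hence [s <= scale j] for all
   [j < k]: only tent [k] is visible at [s]. *)
have [{}k {}ks kmin] := find_ex_minn (ex_intro _ k ks : exists k, 3 * scale k.+1 < s).
have sk j : (j < k)%N -> s <= scale j.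
  move=> jk; case: k jk ks kmin => // k; rewrite ltnS => jk ks kmin.
  have [lt|ge] := ltrP (3 * scale k.+1) s.
    by have := kmin _ lt; rewrite ltnn.
  by apply: le_trans ge (le_trans (scaleS3 _) (scale_le jk)).
have [w [d [w2 d0 wd]]] := tent_left_affine (scale k) s.
(* The second bound keeps [s - h] to the right of all smaller tents. *)
exists w, (Num.min d (s - 3 * scale k.+1)); split => //.
  by rewrite lt_min d0 subr_gt0.
move=> h /andP[h0]; rewrite lt_min => /andP[hd hs].
rewrite (@tents_local k s)//; last exact: ltW.
rewrite (@tents_local k (s - h)); first by apply: wd; rewrite h0.
- lra.
- by move=> j /sk; lra.
Qed.

End Bumps.

(** * Quasiconformality *)

Section Quasiconformality.
Context {R : realType}.
Implicit Types (U K : set (plane R)) (g : plane R -> R) (z v : plane R)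
  (r s t C L : R).

Lemma enorm_ge0 z : 0 <= enorm z. Proof. exact: sqrtr_ge0. Qed.

Lemma enorm_sqr z : enorm z ^+ 2 = z.1 ^+ 2 + z.2 ^+ 2.
Proof. by rewrite sqr_sqrtr// addr_ge0// sqr_ge0. Qed.

Lemma enorm_le z r : 0 <= r -> (enorm z <= r) = (z.1 ^+ 2 + z.2 ^+ 2 <= r ^+ 2).
Proof. by move=> r0; rewrite -enorm_sqr ler_sqr// nnegrE ?enorm_ge0. Qed.

Lemma enorm_fst z : `|z.1| <= enorm z.
Proof. by rewrite /enorm -sqrtr_sqr ler_wsqrtr// lerDl sqr_ge0. Qed.

Lemma enorm_snd z : `|z.2| <= enorm z.
Proof. by rewrite /enorm -sqrtr_sqr ler_wsqrtr// lerDr sqr_ge0. Qed.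

Lemma norm_le_enorm z : `|z| <= enorm z.
Proof. by rewrite prod_normE ge_max enorm_fst enorm_snd. Qed.

Lemma continuous_enorm : continuous (@enorm R).
Proof.
move=> z; apply: (continuous_comp (f := fun z => z.1 ^+ 2 + z.2 ^+ 2));
  last exact: sqrt_continuous.
by apply: cvgD; apply: cvgM; (exact: cvg_fst || exact: cvg_snd).
Qed.

Lemma open_disk r : open (@disk R r).
Proof.
have -> : disk r = @enorm R @^-1` [set x | x < r] by [].
by apply: open_comp; [move=> z _; exact: continuous_enorm|exact: open_lt].
Qed.

(** A compact set is closed, hence measurable, and lies in a box, hence has finite measure. *)
Lemma bounded_L2_loc U g C : open U ->
  @measurable_fun _ _ (mplane R) (measurableTypeR R) setT g ->
  (forall z, U z -> `|g z| <= C) -> L2_loc U g.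
Proof.
move=> oU mg gC; split.
  apply: measurable_funS mg => //; exact: open_mplane_measurable.
move=> K KU cK.
have mK : measurable (K : set (mplane R)).
  rewrite -[K]setCK; apply: measurableC; apply: open_mplane_measurable.
  by rewrite openC; apply: compact_closed => //; exact: norm_hausdorff.
have [M [_ hM]] := compact_bounded cK.
have KM : K `<=` box (`|M| + 1).
  by move=> z Kz; apply: (hM (`|M| + 1)); rewrite // (le_lt_trans (ler_norm M))// ltrDl.
have Koo : (lambda2 K < +oo)%E.
  apply: le_lt_trans (lambda2_box_lty (`|M| + 1)).
  by apply: le_measure; rewrite ?inE//; exact: measurable_box.
apply: (@le_lt_trans _ _ (\int[lambda2]_(z in (K : set (mplane R))) (C ^+ 2)%:E)%E).
  apply: ge0_le_integral => //.
  - by move=> z _; rewrite lee_fin sqr_ge0.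
  - apply/measurable_EFinP; apply: measurable_funX.
    exact: measurable_funS mg.
  - move=> z Kz; rewrite lee_fin -real_normK ?num_real// lerXn2r ?nnegrE//.
      by apply: le_trans (gC z (KU z Kz)); exact: normr_ge0.
    exact: gC (KU z Kz).
by rewrite integral_cst// lte_mul_pinfty ?lee_fin ?sqr_ge0.
Qed.

Lemma lipschitz_continuous (h : R -> R) L : 0 < L ->
  (forall s t, `|h s - h t| <= L * `|s - t|) -> continuous h.
Proof.
move=> L0 hL s; apply/cvgrPdist_lt => e e0; near=> t.
apply: le_lt_trans (hL _ _) _; rewrite mulrC -ltr_pdivlMr//.
by near: t; apply: cvgr_dist_lt; rewrite ?divr_gt0.
Unshelve. all: by end_near. Qed.

(** * The one-variable profile *)

Definition profile s : R := s - tents s.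

Lemma tents_continuous : continuous (@tents R).
Proof.
apply: (@lipschitz_continuous _ 2^-1) => // s t.
by rewrite mulrC; exact: tents_lipschitz.
Qed.

Lemma profile_continuous : continuous profile.
Proof. by move=> s; apply: cvgB; [exact: cvg_id|exact: tents_continuous]. Qed.

(** [tents] is 1/2-Lipschitz. This lower bound yields injectivity and, later, a 2-Lipschitz
    inverse. *)
Lemma profile_expansion s t : s <= t -> (t - s) / 2 <= profile t - profile s.
Proof.
move=> st; have := tents_lipschitz t s; rewrite ler_norml => /andP[_].
by rewrite (ger0_norm (_ : 0 <= t - s)) ?subr_ge0// /profile; lra.
Qed.

Lemma profile_inj : injective profile.
Proof.
move=> s t st; have [h|h] := lerP s t.
  by have := profile_expansion h; rewrite st; lra.
by have := profile_expansion (ltW h); rewrite st; lra.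
Qed.

Lemma profile_norm s : `|profile s| <= `|s|.
Proof.
rewrite /profile; have [s0|/ltW s0] := lerP s 0; first by rewrite tents_neg ?subr0.
have := tents_le_half s0; have := tents_ge0 s => ? ?.
by rewrite !ger0_norm//; lra.
Qed.

(* The left derivative of [tents]; on the right it does not exist at 0. *)
Definition slope s : R := projT1 (cid (tents_left_affine s)).

Lemma slope_bound s : `|slope s| <= 1 / 2.
Proof. by rewrite /slope; case: cid => w [d []]. Qed.

Lemma slope_left_affine s : exists2 d : R, 0 < d &
  forall h : R, 0 <= h < d -> tents (s - h) = tents s - slope s * h.
Proof. by rewrite /slope; case: cid => w [d [? ? ?]]; exists d. Qed.

(** The sequence is eventually constant, since [tents] is affine just to the left of [s]. *)
Lemma profile_left_quotient s :
  n.+1%:R * (profile s - profile (s - n.+1%:R^-1)) @[n --> \oo] --> 1 - slope s.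
Proof.
have [d d0 sd] := slope_left_affine s.
apply: cvg_near_cst.
have /cvgrPdist_lt /(_ _ d0) := @cvg_harmonic R.
apply: filterS => n; rewrite /= sub0r normrN gtr0_norm ?invr_gt0 ?ltr0n// => nd.
rewrite /profile sd ?invr_ge0 ?ler0n//=.
have : n.+1%:R != 0 :> R by rewrite pnatr_eq0.
by move: (n.+1%:R : R) => m m0; field.
Qed.

(** [slope] is defined by choice, so measurability is obtained by viewing [1 - slope] as a pointwise
    limit of continuous difference quotients. *)
Lemma measurable_slope :
  @measurable_fun _ _ (measurableTypeR R) (measurableTypeR R) setT slope.
Proof.
have -> : slope = (fun s => 1 - (1 - slope s)) by apply/funext => s; ring.
apply: measurable_funB => //.
apply: (@measurable_fun_cvg _ _ _ _
  (fun n s => n.+1%:R * (profile s - profile (s - n.+1%:R^-1)))).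
  move=> n; apply: continuous_measurable_fun => s.
  apply: cvgM; first exact: cvg_cst.
  apply: cvgB; first exact: profile_continuous.
  apply: (continuous_comp (f := fun s => s - n.+1%:R^-1));
    last exact: profile_continuous.
  by apply: cvgB; [exact: cvg_id|exact: cvg_cst].
by move=> s _; exact: profile_left_quotient.
Qed.

(** * The planar map and its dilatation *)

Definition tentmap z : plane R := (profile z.1, z.2).

Lemma tentmap_continuous : continuous tentmap.
Proof.
move=> z.
have c1 : profile w.1 @[w --> z] --> profile z.1.
  by apply: (continuous_comp (f := fst)); [exact: cvg_fst|exact: profile_continuous].
have c2 : w.2 @[w --> z] --> z.2 by exact: cvg_snd.
exact: (cvg_pair c1 c2).
Qed.

Lemma tentmap_inj : injective tentmap.
Proof. by move=> [x y] [x' y'] [/profile_inj-> ->]. Qed.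

Lemma tentmap_enorm z : enorm (tentmap z) <= enorm z.
Proof.
rewrite /enorm ler_wsqrtr// lerD2r/=.
rewrite -[leLHS]real_normK ?num_real// -[leRHS]real_normK ?num_real//.
by rewrite lerXn2r ?nnegrE// profile_norm.
Qed.

Definition jacobian z : 'M[R]_2 :=
  \matrix_(i, j) (if i == j then if i == 0 then 1 - slope z.1 else 1 else 0).

(** Each component is Lipschitz and its left difference quotients converge everywhere, to the
    entries of [jacobian]. Square integrability follows from boundedness, of [U] for the components
    and of [slope] for the derivatives. *)
Lemma tentmap_weak_jacobian U : open U -> bounded_set U ->
  weak_jacobian U tentmap jacobian.
Proof.
move=> oU [M [_ hM]].
have UM z : U z -> `|z| <= `|M| + 1.
  by apply: hM; rewrite (le_lt_trans (ler_norm M))// ltrDl.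
have c1 : continuous (fun z => (tentmap z).1).
  move=> z; apply: (continuous_comp (f := tentmap)); last exact: cvg_fst.
  exact: tentmap_continuous.
have c2 : continuous (fun z => (tentmap z).2) by move=> z; exact: cvg_snd.
rewrite /weak_jacobian.
have -> : (fun z => jacobian z 0 0) = fun z => 1 - slope z.1.
  by apply/funext => z; rewrite mxE.
have -> : (fun z => jacobian z 0 1) = fun=> 0 by apply/funext => z; rewrite mxE.
have -> : (fun z => jacobian z 1 0) = fun=> 0 by apply/funext => z; rewrite mxE.
have -> : (fun z => jacobian z 1 1) = fun=> 1 by apply/funext => z; rewrite mxE.
split; split.
- apply: (@bounded_L2_loc _ _ (`|M| + 1)) => //; first exact: continuous_mplane_measurable.
  move=> z /UM; apply: le_trans; apply: (le_trans (profile_norm _)).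
  by rewrite prod_normE le_max lexx.
- apply: (@bounded_L2_loc _ _ (3 / 2)) => //.
    apply: measurable_funB => //; apply: measurableT_comp => //.
    exact: measurable_slope.
  move=> z _; have := slope_bound z.1; rewrite !ler_norml => /andP[? ?].
  by apply/andP; split; lra.
- by apply: (@bounded_L2_loc _ _ 0) => // z _; rewrite normr0.
- apply: (@lipschitz_weak_derivative _ _ _ _ _ (3 / 2)) => // [z s s0|z] /=.
    have := tents_lipschitz z.1 (z.1 - s).
    rewrite [s%:A]mulr1 subKr (gtr0_norm s0) /profile !ler_norml => /andP[? ?].
    by apply/andP; split; lra.
  rewrite (_ : (fun n : nat => _) = fun n : nat =>
      n.+1%:R * (profile z.1 - profile (z.1 - n.+1%:R^-1))).
    exact: profile_left_quotient.
  by apply/funext => n; rewrite [_%:A]mulr1.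
- apply: (@lipschitz_weak_derivative _ _ _ _ _ 0) => // [z s s0|z] /=.
    by rewrite [s *: 0]mulr0 subr0 subrr normr0 mul0r.
  rewrite (_ : (fun n : nat => _) = cst 0); first exact: cvg_cst.
  by apply/funext => n; rewrite [_ *: 0]mulr0 subr0 subrr mulr0.
- apply: (@bounded_L2_loc _ _ (`|M| + 1)) => //; first exact: continuous_mplane_measurable.
  by move=> z /UM; apply: le_trans; rewrite prod_normE le_max lexx orbT.
- by apply: (@bounded_L2_loc _ _ 0) => // z _; rewrite normr0.
- by apply: (@bounded_L2_loc _ _ 1) => // z _; rewrite normr1.
- apply: (@lipschitz_weak_derivative _ _ _ _ _ 0) => // [z s s0|z] /=.
    by rewrite [s *: 0]mulr0 subr0 subrr normr0 mul0r.
  rewrite (_ : (fun n : nat => _) = cst 0); first exact: cvg_cst.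
  by apply/funext => n; rewrite [_ *: 0]mulr0 subr0 subrr mulr0.
- apply: (@lipschitz_weak_derivative _ _ _ _ _ 1) => // [z s s0|z] /=.
    by rewrite [s%:A]mulr1 subKr gtr0_norm// mul1r.
  rewrite (_ : (fun n : nat => _) = cst 1); first exact: cvg_cst.
  by apply/funext => n; rewrite [_%:A]mulr1 subKr mulfV// pnatr_eq0.
Qed.

(** As [1 - slope z.1] lies between 1/2 and 3/2, the squared norm is at most 9/4 and the determinant
    at least 1/2; [9 / 2] is the quotient of these bounds. *)
Lemma tentmap_dilatation z : opnorm (jacobian z) ^+ 2 <= 9 / 2 * \det (jacobian z).
Proof.
have := slope_bound z.1; rewrite ler_norml => /andP[w1 w2].
have op h : enorm h <= 1 -> enorm (mxapply (jacobian z) h) <= 3 / 2.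
  rewrite !enorm_le ?divr_ge0// /mxapply !mxE/= !mul0r addr0 add0r mul1r expr1n => h1.
  have p2 : (1 - slope z.1) ^+ 2 <= 9 / 4 by nra.
  have := ler_wpM2r (sqr_ge0 h.1) p2; have := sqr_ge0 h.2.
  by rewrite exprMn expr_div_n; lra.
have opub : ubound
    [set enorm (mxapply (jacobian z) h) | h in [set h | enorm h <= 1]] (3 / 2).
  by move=> _ [h /= h1 <-]; exact: op.
have h0 : enorm (0 : plane R) <= 1.
  by rewrite enorm_le//= !expr0n addr0 expr1n ler01.
have op0 : 0 <= opnorm (jacobian z).
  apply: le_trans (enorm_ge0 (mxapply (jacobian z) 0)) _.
  by apply: ub_le_sup; [exists (3 / 2)|exists 0].
have op32 : opnorm (jacobian z) <= 3 / 2.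
  by apply: ge_sup => //; exists (enorm (mxapply (jacobian z) 0)), 0.
have -> : \det (jacobian z) = 1 - slope z.1.
  rewrite det_trig; first by rewrite !big_ord_recl big_ord0 !mxE/= !mulr1.
  apply/is_trig_mxP => i j ij; rewrite mxE; case: eqP ij => // ->.
  by rewrite ltnn.
by nra.
Qed.

Lemma tentmap_quasiconformal U : open U -> bounded_set U -> quasiconformal U tentmap.
Proof.
move=> oU bU; split; last by move=> z w _ _; exact: tentmap_inj.
split; first by apply: continuous_subspaceT => z; exact: tentmap_continuous.
exists jacobian; first exact: tentmap_weak_jacobian.
exists (9 / 2); first lra.
by apply: aeW => z _; exact: tentmap_dilatation.
Qed.

End Quasiconformality.

(** * Generalized derivatives *)

Section InfinitesimalSpace.
Context {R : realType}.
Implicit Types (z w : plane R) (r s t d rho M : R).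

Lemma disk_measurable r : measurable (disk r : set (mplane R)).
Proof. by apply: open_mplane_measurable; exact: open_disk. Qed.

Lemma lambda2_disk t : 0 < t -> lambda2 (@disk R t) = ((t ^+ 2)%:E * lambda2 (@disk R 1))%E.
Proof.
move=> t0; rewrite (lambda2_affine 0 t0 (disk_measurable t)); congr (_ * lambda2 _)%E.
apply/funext => z; apply/propext; rewrite /preimage /disk/= add0r.
have -> : enorm (t *: z) = t * enorm z.
  rewrite /enorm/= !exprMn -mulrDr sqrtrM ?sqr_ge0//.
  by rewrite sqrtr_sqr gtr0_norm.
by rewrite -[X in _ < X]mulr1 ltr_pM2l.
Qed.

Lemma lambda2_disk_lty t : (lambda2 (@disk R t) < +oo)%E.
Proof.
apply: le_lt_trans (lambda2_box_lty t); apply: le_measure; rewrite ?inE.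
- exact: disk_measurable.
- exact: measurable_box.
- by move=> z /ltW; exact: le_trans (norm_le_enorm z).
Qed.

Lemma lambda2_disk1_gt0 : 0 < fine (lambda2 (@disk R 1)).
Proof.
apply: fine_gt0; rewrite lambda2_disk_lty andbT.
(* The unit disk contains this square of area 1, whose corners have squared modulus 1/2. *)
apply: (@lt_le_trans _ _ (lambda2 (box (1 / 2 : R)))).
  rewrite box_setX.
  have -> : lambda2 (`[- (1 / 2) : R, 1 / 2] `*` `[- (1 / 2), 1 / 2]) =
      (lebesgue_measure (`[(- (1 / 2))%R, (1 / 2)%R]%classic : set R) *
       lebesgue_measure (`[(- (1 / 2))%R, (1 / 2)%R]%classic : set R))%E.
    by apply: product_measure1E; exact: measurable_itv.
  rewrite !lebesgue_measure_itv/= lte_fin ifT; last lra.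
  by rewrite -EFinB -EFinM lte_fin; nra.
apply: le_measure; rewrite ?inE.
- exact: measurable_box.
- exact: disk_measurable.
- rewrite box_setX => z [/=]; rewrite !in_itv/= => /andP[? ?] /andP[? ?].
  rewrite /disk/= -(@ltr_pXn2r _ 2)// ?nnegrE ?enorm_ge0// enorm_sqr expr1n.
  nra.
Qed.

(** * The inverse map and the areas of images of disks *)

Lemma profile_surj s : exists t, profile t = s.
Proof.
have [s0|s0] := lerP s 0; first by exists s; rewrite /profile tents_neg ?subr0.
have [|||t _ <-] := @IVT R profile 0 (2 * s) s; last by exists t.
- lra.
- by apply: continuous_subspaceT => t; exact: profile_continuous.
- have p0 : profile (0 : R) = 0 by rewrite /profile tents_neg ?subr0.
  have p2 : s <= profile (2 * s).
    by have := @tents_le_half R (2 * s); rewrite /profile; lra.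
  by rewrite p0 ge_min le_max (ltW s0) p2 orbT.
Qed.

Definition profile_inv s : R := projT1 (cid (profile_surj s)).

Lemma profile_invK s : profile (profile_inv s) = s.
Proof. by rewrite /profile_inv; case: cid. Qed.

Lemma profile_inv_continuous : continuous profile_inv.
Proof.
apply: (@lipschitz_continuous _ _ 2) => // s t.
wlog st : s t / profile_inv t <= profile_inv s.
  move=> H; case/orP: (le_total (profile_inv t) (profile_inv s)) => /H//.
  by rewrite distrC (distrC t).
have := profile_expansion st; rewrite !profile_invK ger0_norm ?subr_ge0//.
by have := ler_norm (s - t); lra.
Qed.

Lemma tentmap_image_disk t :
  tentmap @` disk t = [set z | disk t (profile_inv z.1, z.2)].
Proof.
apply/seteqP; split => [_ [z zt <-]|z zt] /=.
  have -> : profile_inv (profile z.1) = z.1.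
    by apply: profile_inj; rewrite profile_invK.
  by case: z zt.
exists (profile_inv z.1, z.2) => //.
by rewrite /tentmap/= profile_invK; case: z zt.
Qed.

(** The image is the preimage of a disk under the continuous inverse. Openness makes it measurable,
    as the comparison of areas requires. *)
Lemma open_tentmap_image_disk t : open (tentmap @` @disk R t).
Proof.
rewrite tentmap_image_disk.
apply: (@open_comp _ _ (fun z : plane R => (profile_inv z.1, z.2) : plane R)) => [z _|].
  have c1 : profile_inv w.1 @[w --> z] --> profile_inv z.1.
    by apply: (continuous_comp (f := fst)); [exact: cvg_fst|exact: profile_inv_continuous].
  have c2 : w.2 @[w --> z] --> z.2 by exact: cvg_snd.
  exact: (cvg_pair c1 c2).
exact: open_disk.
Qed.

Lemma tentmap_image_sub t : tentmap @` disk t `<=` @disk R t.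
Proof. by move=> _ [z zt <-]; exact: le_lt_trans (tentmap_enorm z) zt. Qed.

(** The inverse map increases the modulus by at most [d], because [profile] displaces coordinates up
    to [t] by at most [d]. *)
Lemma tentmap_image_sup t d : 0 <= d -> (forall s, s <= t -> tents s <= d) ->
  @disk R (t - d) `<=` tentmap @` disk t.
Proof.
move=> d0 td; rewrite tentmap_image_disk => z zt /=; rewrite /disk/=.
set x := profile_inv z.1; have xz : profile x = z.1 by exact: profile_invK.
have zE := enorm_fst z; rewrite /disk/= in zt.
have xle : `|x| <= `|z.1| + d.
  have [x0|x0] := lerP x 0.
    by rewrite -xz /profile tents_neg// subr0 lerDl.
  have z0 : 0 <= z.1.
    by rewrite -xz /profile; have := tents_le_half (ltW x0); lra.
  (* It is not yet known that [x <= t], so the bound on [tents] is applied at [z.1 + d], which is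
     below [t]: there [profile] is already at least [z.1], and monotonicity excludes a larger
     [x]. *)
  rewrite (gtr0_norm x0) (ger0_norm z0) leNgt; apply/negP => xgt.
  have := profile_expansion (ltW xgt); rewrite xz.
  have : tents (z.1 + d) <= d by apply: td; move: zE; rewrite ger0_norm//; lra.
  rewrite {1}/profile; lra.
suff : enorm (x, z.2) <= enorm z + d by lra.
rewrite enorm_le ?addr_ge0 ?enorm_ge0//= sqrrD enorm_sqr.
have x2 : x ^+ 2 <= (`|z.1| + d) ^+ 2.
  by rewrite -(real_normK (num_real x)) lerXn2r ?nnegrE ?addr_ge0.
rewrite sqrrD real_normK ?num_real// in x2.
have : `|z.1| * d <= enorm z * d by rewrite ler_wpM2r.
by rewrite !mulr2n in x2 *; lra.
Qed.

(** The image of the disk lies between the concentric disks of radii [t - d] and [t], so its area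
    does too. *)
Lemma mean_radius_tentmap t d : 0 <= d < t -> (forall s, s <= t -> tents s <= d) ->
  t - d <= mean_radius tentmap t <= t.
Proof.
move=> /andP[d0 dt] td; have l0 := lambda2_disk1_gt0.
have mI : measurable (tentmap @` disk t : set (mplane R)).
  by apply: open_mplane_measurable; exact: open_tentmap_image_disk.
have fineD s : 0 < s -> fine (lambda2 (disk s)) = s ^+ 2 * fine (lambda2 (@disk R 1)).
  move=> s0; rewrite lambda2_disk// fineM// ge0_fin_numE ?measure_ge0//.
  exact: lambda2_disk_lty.
have fin (A : set (mplane R)) : A `<=` disk t -> measurable A -> lambda2 A \is a fin_num.
  move=> At mA; rewrite ge0_fin_numE ?measure_ge0//.
  apply: le_lt_trans (lambda2_disk_lty t); apply: le_measure; rewrite ?inE//.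
  exact: disk_measurable.
have finI := fin _ (@tentmap_image_sub t) mI.
have h1 : fine (lambda2 (tentmap @` disk t)) <= t ^+ 2 * fine (lambda2 (@disk R 1)).
  rewrite -fineD; last lra.
  apply: fine_le => //; first by apply: fin => //; exact: disk_measurable.
  apply: le_measure; rewrite ?inE//; first exact: disk_measurable.
  exact: tentmap_image_sub.
have h2 : (t - d) ^+ 2 * fine (lambda2 (@disk R 1)) <= fine (lambda2 (tentmap @` disk t)).
  rewrite -fineD; last lra.
  have sub := tentmap_image_sup d0 td.
  apply: fine_le => //.
    by apply: fin; [exact: subset_trans sub (@tentmap_image_sub t)|exact: disk_measurable].
  by apply: le_measure; rewrite ?inE//; exact: disk_measurable.
rewrite /mean_radius; apply/andP; split.
  rewrite -[leLHS]ger0_norm ?subr_ge0 ?(ltW dt)// -sqrtr_sqr ler_wsqrtr//.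
  by rewrite ler_pdivlMr.
rewrite -[leRHS]ger0_norm ?(le_trans d0 (ltW dt))// -sqrtr_sqr ler_wsqrtr//.
by rewrite ler_pdivrMr.
Qed.

(** * Convergence of the rescaled maps *)

Definition limit_map rho z : plane R := (z.1 - tent rho z.1, z.2).

(** Applied to one coordinate at a time: [m] is the mean radius, [B] the coordinate before
    normalization, [P] its expected limit. The error splits into [B - t * P] and [(t - m) * P], and
    [m >= t / 2] controls the division. *)
Lemma renormalization_error (B P t d m Q : R) : 0 < t -> 0 <= d -> 2 * d <= t ->
  t - d <= m <= t -> `|B - t * P| <= d -> `|P| <= Q ->
  `|m^-1 * B - P| <= 2 * (d / t) * (1 + Q).
Proof.
move=> t0 d0 dt /andP[m1 m2] hB hP.
have m0 : 0 < m by lra.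
have -> : m^-1 * B - P = m^-1 * ((B - t * P) + (t - m) * P).
  by field; rewrite gt_eqF.
have Q0 : 0 <= Q by exact: le_trans hP.
have h : `|(B - t * P) + (t - m) * P| <= d * (1 + Q).
  apply: le_trans (ler_normD _ _) _; rewrite mulrDr mulr1 lerD//.
  by rewrite normrM ger0_norm ?subr_ge0// ler_pM// ?subr_ge0//; lra.
rewrite normrM gtr0_norm ?invr_gt0// ler_pdivrMl//.
apply: le_trans h _; rewrite [leRHS]mulrA ler_wpM2r ?addr_ge0//.
rewrite (_ : m * _ = d * (2 * m / t)); last by ring.
by rewrite ler_peMr// ler_pdivlMr// mul1r; lra.
Qed.

(** With [t = scale k / rho] and [d = scale k.+1] one has [d / t = rho / k.+3%:R]. The condition on
    [rho] gives [2 * d <= t]; the one on [M] keeps the window of size [t * M] to the left of all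
    larger tents. *)
Lemma rescale_tentmap_close rho (k : nat) M z : 1 <= rho ->
  2 * rho <= k.+3%:R -> M <= k.+2%:R -> `|z| <= M ->
  `|rescale tentmap (scale k / rho) z - limit_map rho z| <=
  2 * (rho / k.+3%:R) * (1 + (M + rho)).
Proof.
move=> rho1 rhok Mk zM.
have M0 : 0 <= M by exact: le_trans zM.
have rho0 : 0 < rho by lra.
have c0 : 0 < scale k :> R by exact: scale_gt0.
set t := scale k / rho; have t0 : 0 < t by rewrite divr_gt0.
have tc : t <= scale k by rewrite ler_pdivrMr// ler_peMr// ltW.
have trho : t * rho = scale k by rewrite divfK// gt_eqF.
have k3 : 0 < k.+3%:R :> R by rewrite ltr0n.
set d : R := scale k.+1; have d0 : 0 < d by exact: scale_gt0.
have dt : d / t = rho / k.+3%:R.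
  rewrite /d /t scaleS; move: k3 c0.
  move: (k.+3%:R : R) (scale k : R) => K c K0 c0.
  by field; rewrite !gt_eqF.
have d2t : 2 * d <= t.
  rewrite -[d](divfK (lt0r_neq0 t0)) dt mulrA ler_piMl ?(ltW t0)//.
  by rewrite mulrA ler_pdivrMr// mul1r.
(* For positive [k], [t * M] is at most [scale k * k.+2%:R], which is the preceding scale; for
   [k = 0] there is nothing to prove. *)
have near_scale s : s <= t * M -> forall j, (j < k)%N -> s <= scale j.
  move=> sM j.
  case: k Mk {zM rhok trho k3 d d0 dt d2t} t tc t0 sM c0 => //.
  move=> k Mk t tc t0 sM c0 jk.
  have : scale k <= scale j :> R by exact: scale_le.
  apply: le_trans; apply: le_trans sM _.
  apply: (@le_trans _ _ (scale k.+1 * k.+3%:R)).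
    by rewrite ler_pM// ltW.
  by rewrite scaleS divfK// gt_eqF.
(* Since [rho >= 1], [t] does not exceed [scale k], where tent [k] begins; only the smaller tents
   can affect the area. *)
have small s : s <= t -> tents s <= d.
  move=> st; have sj j : (j < k)%N -> s <= scale j.
    by move=> jk; apply: le_trans (le_trans st tc) (scale_le _); exact: ltnW.
  have := tents_approx sj; rewrite tent_left0 ?(le_trans st)// subr0.
  by rewrite ger0_norm ?tents_ge0.
have dlt : 0 <= d < t by lra.
have mb := mean_radius_tentmap dlt small.
have zxy := zM; rewrite prod_normE ge_max in zxy; have /andP[xM yM] := zxy.
have -> : rescale tentmap t z =
    ((mean_radius tentmap t)^-1 * profile (t * z.1),
     (mean_radius tentmap t)^-1 * (t * z.2)).
  have b0 : tentmap 0 = 0 :> plane R by rewrite /tentmap /profile tents_neg ?subr0.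
  by rewrite /rescale b0 subr0.
rewrite prod_normE ge_max/=; apply/andP; split.
  rewrite -dt; apply: renormalization_error => //; first lra.
  - have -> : profile (t * z.1) - t * (z.1 - tent rho z.1) =
        - (tents (t * z.1) - tent (scale k) (t * z.1)).
      by rewrite -trho tent_scale ?(ltW t0)// /profile; ring.
    rewrite normrN; apply: tents_approx; apply: near_scale.
    by rewrite ler_pM2l// (le_trans (ler_norm _)).
  - have := tent_ge0 rho z.1; have := tent_le z.1 (ltW rho0).
    move: xM; rewrite !ler_norml => /andP[? ?] ? ?.
    by apply/andP; split; lra.
rewrite -dt; apply: renormalization_error => //; first lra.
- by rewrite subrr normr0 ltW.
- by apply: le_trans yM _; lra.
Qed.

Lemma cvg_locally_uniformly_box (F : nat -> plane R -> plane R) (f : plane R -> plane R) :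
  (forall M e : R, 0 < e -> \forall k \near \oo,
     forall z, `|z| <= M -> `|F k z - f z| < e) ->
  cvg_locally_uniformly F f.
Proof.
move=> H z; exists [set w | `|w| < `|z| + 1].
  apply/nbhs_ballP; exists 1 => /= [|w]; first exact: ltr01.
  rewrite -ball_normE/= => zw.
  by have := ler_normB z (z - w); rewrite subKr; lra.
move=> P /uniform_nbhs [E [entE EP]].
move: entE; rewrite -entourage_ballE => -[e /= e0 eE].
have := H (`|z| + 1) e e0; apply: filterS => k Hk.
apply: EP => w /ltW wz; apply: eE => /=.
by rewrite -ball_normE/= distrC; exact: Hk.
Qed.

Lemma limit_map_generalized_derivative rho : 1 <= rho ->
  infinitesimal_space tentmap (limit_map rho).
Proof.
move=> rho1; have rho0 : 0 < rho by lra.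
exists (fun k => scale k / rho); split.
- move=> k; rewrite divr_gt0 ?scale_gt0//= ltr_pdivrMr// mul1r.
  exact: lt_le_trans (scale_lt1 k) rho1.
- apply/decreasing_seqP => k; rewrite ltr_pM2r ?invr_gt0//.
  by have := @scaleS3 R k; have := @scale_gt0 R k.+1; lra.
- rewrite -(mul0r rho^-1); apply: cvgM; [exact: scale_cvg0|exact: cvg_cst].
- apply: cvg_locally_uniformly_box => M e e0.
  (* [k] is taken beyond three thresholds: the two size conditions of the estimate, and the value
     making its bound, of order [1 / k], smaller than [e]. *)
  near=> k => z zM.
  have M0 : 0 <= M by exact: le_trans zM.
  have hk : k%:R < k.+3%:R :> R by rewrite ltr_nat; exact: ltnW (leqnSn k.+2).
  have hk2 : k%:R < k.+2%:R :> R by rewrite ltr_nat; exact: leqnSn k.+1.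
  have k3 : 0 < k.+3%:R :> R by rewrite ltr0n.
  apply: le_lt_trans (@rescale_tentmap_close rho k M z rho1 _ _ zM) _.
  + apply: ltW; apply: le_lt_trans hk; near: k; exact: nbhs_infty_ger.
  + apply: ltW; apply: le_lt_trans hk2; near: k; exact: nbhs_infty_ger.
  + rewrite mulrA mulrAC ltr_pdivrMr// [ltRHS]mulrC -ltr_pdivrMr//.
    apply: le_lt_trans hk; near: k; exact: nbhs_infty_ger.
Unshelve. all: by end_near. Qed.

End InfinitesimalSpace.

Theorem proposition5p1 (R : realType) :
  exists f : plane R -> plane R,
    [/\ quasiconformal (disk 1) f,
        set_fun (disk 1) (disk 1) f &
        forall r : R, 0 < r ->
          exists g1 g2 : plane R -> plane R,
            [/\ infinitesimal_space f g1, infinitesimal_space f g2,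
                g1 <> g2 & forall z : plane R, enorm z < r -> g1 z = g2 z]].
Proof.
exists tentmap; split.
- apply: tentmap_quasiconformal; first exact: open_disk.
  exists 1; split => // M M1 z z1 /=.
  by apply: le_trans (ltW M1); apply: le_trans (norm_le_enorm z) (ltW z1).
- by move=> z z1; exact: le_lt_trans (tentmap_enorm z) z1.
(* Both parameters exceed [r] and 1, so both tents start outside the disk of radius [r]. The second
   starts at [2 * (1 + r)], exactly where the first one peaks, and this point separates the two
   maps. *)
move=> r r0; exists (limit_map (1 + r)), (limit_map (2 * (1 + r))); split.
- by apply: limit_map_generalized_derivative; lra.
- by apply: limit_map_generalized_derivative; lra.
- move=> /(congr1 (fun g => (g (2 * (1 + r), 0)).1)) /=.
  rewrite [tent (2 * _) _]tent_left0// /tent subrr normr0 max_r; lra.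
- move=> z zr; have zr1 : z.1 <= r.
    by apply: le_trans (ler_norm _) _; apply: le_trans (enorm_fst z) (ltW zr).
  by rewrite /limit_map !tent_left0//; lra.
Qed.
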